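(* Let $n\ge 4$, let $G$ be the cyclic subgroup of $\operatorname{Sym}([n])$ generated by the cycle $(1\ 2\ \cdots\ n)$, and let $\mathcal{V}$ be a system of $n$ subsets $V_1,\ldots,V_n$ of $[n]$. Then $G$ satisfies the $(n-1)$-orbit condition subject to $\mathcal{V}$ if and only if $G$ has a $G$-marriage subject to $\mathcal{V}$.
   Context: $[n]=\{1,\ldots,n\}$, and $\operatorname{Sym}([n])$ is the group of all permutations of $[n]$. A system $\mathcal{V}$ of $n$ subsets of $[n]$ is an indexed family $V_1,\ldots,V_n$ with each $V_i\subseteq [n]$. A subgroup $G\le \operatorname{Sym}([n])$ has a $G$-marriage subject to $\mathcal{V}$ if there exists $g\in G$ with $g(i)\in V_i$ for every $i\in[n]$. For $k\in[n]$ and $\mathbf{y}=(y_1,\ldots,y_k)\in[n]^k$ write $V_{\mathbf{y}}=V_{y_1}\times\cdots\times V_{y_k}\subseteq [n]^k$. $G$ satisfies the $k$-orbit condition subject to $\mathcal{V}$ if for every non-empty $Y\subseteq[n]^k$ there is $g\in G$ such that $Y^g\subseteq\bigcup_{\mathbf{y}\in Y}V_{\mathbf{y}}$, where $Y^g=\{(g(y_1),\ldots,g(y_k)) : (y_1,\ldots,y_k)\in Y\}$. *)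

(* Defs.v *)
From mathcomp Require Import all_boot all_fingroup.

Set Implicit Arguments.
Unset Strict Implicit.
Unset Printing Implicit Defensive.

Local Open Scope group_scope.

(* [n] = {1, ..., n} is represented by 'I_n = {0, ..., n - 1}; the point i of
   [n] corresponds to the ordinal i - 1. *)

Definition marriage (n : nat) (G : {group {perm 'I_n}})
    (V : 'I_n -> {set 'I_n}) : Prop :=
  exists2 g : {perm 'I_n}, g \in G & forall i : 'I_n, g i \in V i.

Definition tuple_setX (n k : nat) (V : 'I_n -> {set 'I_n})
    (y : k.-tuple 'I_n) : {set k.-tuple 'I_n} :=
  [set z : k.-tuple 'I_n | [forall j : 'I_k, tnth z j \in V (tnth y j)]].

Definition tuple_image (n k : nat) (Y : {set k.-tuple 'I_n})
    (g : {perm 'I_n}) : {set k.-tuple 'I_n} :=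
  [set map_tuple g y | y in Y].

Definition orbit_condition (n k : nat) (G : {group {perm 'I_n}})
    (V : 'I_n -> {set 'I_n}) : Prop :=
  forall Y : {set k.-tuple 'I_n}, Y != set0 ->
    exists2 g : {perm 'I_n}, g \in G &
      tuple_image Y g \subset \bigcup_(y in Y) tuple_setX V y.

(* ordS sends i to i + 1 modulo n, so this is the n-cycle (1 2 ... n). *)
Definition long_cycle (n : nat) : {perm 'I_n} := perm (@ordS_inj n).

Definition cyclic_sym (n : nat) : {group {perm 'I_n}} := <[long_cycle n]>%G.

(* Main.v *)
Require Import Defs.
From mathcomp Require Import all_boot all_fingroup.
From mathcomp Require Import ssralg zmodp ring.

Set Implicit Arguments.
Unset Strict Implicit.
Unset Printing Implicit Defensive.

Import GRing.Theory.

(** Identify the points with the residues modulo n, so that the group consists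
    of the translations by the residues a.  A marriage by translations maps
    every y in Y into V_y, which gives one direction with a single group
    element for all Y.

    For the converse, suppose that every translation a is defeated by some
    point x, meaning that x + a lies outside V_x.  It is enough to build rows
    y^1, ..., y^m of length n - 1 such that for each a some row i satisfies:
    for every j there is a position k where y^i_k + a is outside V of y^j_k.
    Then the set Y of these rows violates the orbit condition
    (blocks_not_orbit_condition).  The rows are best described by their n - 1
    columns, and a column constantly equal to x deals at once with every
    translation defeated by x.  If constant columns are used for all points
    outside a list E, then fewer than #E columns must deal with the remaining
    translations (few_columns_not_orbit_condition).

    For each a choose a point defeating it.  If the choice misses a point u,
    then E = {u} works without further columns.  Otherwise the choice is a
    bijection; write alpha for its inverse and c x = x + alpha x for the
    forbidden value at x.  The column (.., x, .., y, ..) with x in row i and y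
    in row j serves the pair (i, j) for the translation c y - x.
    - If c u = c w with u <> w, the column (u, w) settles E = {u, w}.
    - If c is injective and c u + u <> c w + w, put A = c u - u, B = c w - u
      for row 1 and C = c w - w, D = c u - w for row 2.  These translations are
      distinct and the column (u, w) serves the pairs (1,1) for A, (1,2) for B,
      (2,2) for C and (2,1) for D.  Each of the rows then lacks one service
      for each of its translations, and since c is onto, one column supplies
      both missing services of row 1 and one those of row 2: three columns for
      four points.
    - Otherwise c x = k - x for a constant k.  A pair of entries x, y now
      serves the translation c e - e exactly when x + y = e + e, a condition
      symmetric in x and y, and two rows no longer suffice.  Three rows do:
      the columns (0, 2, 2), (-3, 3, 3), (1, 3, 5) settle E = {0, 1, 2, 3},
      row 1 being responsible for e = 0 and e = 1, row 2 for e = 2 and row 3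
      for e = 3.  The four points of E are distinct because n >= 4. *)

(** * Violating the orbit condition by a list of columns *)

Section Translations.
Local Open Scope ring_scope.

Lemma long_cycleXE (p a : nat) (x : 'I_p.+2) :
  (long_cycle p.+2 ^+ a)%g x = x + a%:R.
Proof.
elim: a => [|a IHa]; first by rewrite expg0 perm1 addr0.
rewrite expgSr permM {}IHa permE mulrSr addrA.
by apply: val_inj; rewrite /= modnDmr addn1.
Qed.

Lemma marriage_orbit_condition (n k : nat) (G : {group {perm 'I_n}})
    (V : 'I_n -> {set 'I_n}) :
  marriage G V -> orbit_condition k G V.
Proof.
move=> [g Gg gV] Y _; exists g => //.
apply/subsetP => _ /imsetP[y Yy ->]; apply/bigcupP; exists y => //.
by rewrite inE; apply/forallP => j; rewrite tnth_map.
Qed.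

(** The rows are the members of the set Y to be constructed, and [i] is the
    index of a row that witnesses the failure of the translation by [a].  They
    are stored by columns because a column acts for all the points of a position at
    once, and several partial lists of columns can be concatenated. *)
Definition blocks (n m : nat) (V : 'I_n.+1 -> {set 'I_n.+1})
    (s : seq (m.-tuple 'I_n.+1)) (a : 'I_n.+1) : Prop :=
  exists i : 'I_m, forall j : 'I_m,
    exists2 c, c \in s & tnth c i + a \notin V (tnth c j).

(** The set Y consists of the rows of the array with columns [s].  A shorter
    list is padded by zero columns, which can only make it harder for a
    translated row to lie in one of the boxes. *)
Lemma blocks_not_orbit_condition (p m : nat) (V : 'I_p.+2 -> {set 'I_p.+2})
    (s : seq (m.-tuple 'I_p.+2)) :
  (size s <= p.+1)%N -> (forall a, blocks V s a) ->
  ~ orbit_condition p.+1 (cyclic_sym p.+2) V.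
Proof.
move=> le_s blk orb.
pose c0 : m.-tuple 'I_p.+2 := [tuple of nseq m 0].
pose y i : p.+1.-tuple 'I_p.+2 := [tuple tnth (nth c0 s k) i | k < p.+1].
have [|_ /cycleP[a ->] /subsetP sub] := orb [set y i | i : 'I_m].
  by have [i _] := blk 0; apply/set0Pn; exists (y i); apply: imset_f.
have [i iP] := blk a%:R.
have /bigcupP[_ /imsetP[j _ ->]] :
    map_tuple (long_cycle p.+2 ^+ a)%g (y i) \in
      \bigcup_(z in [set y i | i : 'I_m]) tuple_setX V z.
  by apply: sub; apply: imset_f; apply: imset_f.
have [c sc /negP ncV] := iP j.
have lt_c : (index c s < p.+1)%N by rewrite (leq_trans _ le_s) ?index_mem.
rewrite inE => /forallP/(_ (Ordinal lt_c)).
by rewrite tnth_map !tnth_mktuple /= nth_index // long_cycleXE.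
Qed.

(** Each point [x] outside [E] contributes a constant column: all rows agree
    there, so that any of them blocks a translation defeated by [x].  One
    column fewer than [E] has points remains for everything else. *)
Lemma few_columns_not_orbit_condition (p m : nat)
    (V : 'I_p.+2 -> {set 'I_p.+2}) (E : seq 'I_p.+2)
    (s : seq (m.+1.-tuple 'I_p.+2)) :
  uniq E -> (size s < size E)%N ->
  (forall a, (exists2 x, x \notin E & x + a \notin V x) \/ blocks V s a) ->
  ~ orbit_condition p.+1 (cyclic_sym p.+2) V.
Proof.
move=> uniqE ltsE hyp.
pose const_col x : m.+1.-tuple 'I_p.+2 := [tuple x | _ < m.+1].
apply: (@blocks_not_orbit_condition _ _ _
  (s ++ [seq const_col x | x <- enum [predC E]])).
  rewrite size_cat size_map -cardE -ltnS -addSn.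
  rewrite -[X in (_ <= X)%N](card_ord p.+2) -(cardC (mem E)).
  by rewrite (card_uniqP uniqE) leq_add2r.
move=> a; case: (hyp a) => [[x Ex nVx]|[i iP]].
  exists ord0 => j; exists (const_col x); last by rewrite !tnth_mktuple.
  by rewrite mem_cat map_f ?orbT // mem_enum.
by exists i => j; have [c sc nVc] := iP j; exists c; rewrite // mem_cat sc.
Qed.

(** * Columns for each shape of the forbidden values *)

Lemma blocks_pair (n : nat) (V : 'I_n.+1 -> {set 'I_n.+1})
    (s : seq (2.-tuple 'I_n.+1)) (a : 'I_n.+1) (i : 'I_2)
    (c d : 2.-tuple 'I_n.+1) :
  c \in s -> d \in s ->
  tnth c i + a \notin V (tnth c ord0) ->
  tnth d i + a \notin V (tnth d ord_max) -> blocks V s a.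
Proof.
move=> sc sd nVc nVd; exists i => j.
have [->|nj] := eqVneq j ord0; first by exists c.
suff -> : j = ord_max by exists d.
by apply: val_inj; case: j nj => [[|[|//]] ?].
Qed.

Lemma blocks_triple (n : nat) (V : 'I_n.+1 -> {set 'I_n.+1})
    (s : seq (3.-tuple 'I_n.+1)) (a : 'I_n.+1) (i : 'I_3)
    (c d e : 3.-tuple 'I_n.+1) :
  c \in s -> d \in s -> e \in s ->
  tnth c i + a \notin V (tnth c (inord 0)) ->
  tnth d i + a \notin V (tnth d (inord 1)) ->
  tnth e i + a \notin V (tnth e (inord 2)) -> blocks V s a.
Proof.
move=> sc sd se nVc nVd nVe; exists i => j; rewrite -[j]inord_val.
by case: j => [[|[|[|//]]] ?]; [exists c | exists d | exists e].
Qed.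

(** A single row listing the points other than [u] meets, for each
    translation, a point that defeats it. *)
Lemma missing_bad_point_not_orbit_condition (p : nat)
    (V : 'I_p.+2 -> {set 'I_p.+2}) (u : 'I_p.+2) :
  (forall a, exists2 x, x != u & x + a \notin V x) ->
  ~ orbit_condition p.+1 (cyclic_sym p.+2) V.
Proof.
move=> bad; apply: (@few_columns_not_orbit_condition p 0 V [:: u] [::]) => // a.
by have [x xu nVx] := bad a; left; exists x; rewrite // inE.
Qed.

(** Two rows that agree outside one position, where they have [u] and [w]:
    since [c u] and [c w] coincide, the translation taking [u] to this value
    avoids both [V u] and [V w], and so does the one taking [w] to it. *)
Lemma bad_values_collide_not_orbit_condition (p : nat)
    (V : 'I_p.+2 -> {set 'I_p.+2})
    (c : 'I_p.+2 -> 'I_p.+2) (u w : 'I_p.+2) :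
  (forall x, c x \notin V x) -> (forall a, exists x, c x = x + a) ->
  u != w -> c u = c w -> ~ orbit_condition p.+1 (cyclic_sym p.+2) V.
Proof.
move=> cV c_onto uw cuw.
apply: (@few_columns_not_orbit_condition p 1 V [:: u; w] [:: [tuple u; w]]) => //.
  by rewrite /= inE uw.
move=> a; have [x cx] := c_onto a.
have [|] := boolP (x \in [:: u; w]); last by left; exists x; rewrite -?cx.
rewrite !inE => /orP[] /eqP xE; subst x; right.
  by apply: (@blocks_pair _ _ _ _ ord0 [tuple u; w] [tuple u; w]);
    rewrite ?inE // !(tnth_nth 0) /= -cx // cuw.
by apply: (@blocks_pair _ _ _ _ ord_max [tuple u; w] [tuple u; w]);
  rewrite ?inE // !(tnth_nth 0) /= -cx // -cuw.
Qed.

(** The column [(u, w)] does half of the work for the four translations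
    [c u - u], [c w - u] (first row) and [c w - w], [c u - w] (second row), and
    the bijectivity of [c] provides one column per row for the other half.
    The hypothesis on [c u + u] and [c w + w] says that [c w - u] and [c u - w]
    differ, and hence that the four points to be replaced are distinct. *)
Lemma bad_values_generic_not_orbit_condition (p : nat)
    (V : 'I_p.+2 -> {set 'I_p.+2})
    (c : 'I_p.+2 -> 'I_p.+2) (u w : 'I_p.+2) :
  (forall x, c x \notin V x) -> (forall a, exists x, c x = x + a) ->
  injective c -> c u + u != c w + w ->
  ~ orbit_condition p.+1 (cyclic_sym p.+2) V.
Proof.
move=> cV c_onto c_inj cuw.
have u_neq_w : u != w by apply: contraNneq cuw => ->.
have cu_neq_cw : c u != c w by rewrite inj_eq.
have c_surj z : exists x, c x = z.
  by have [d _ dK] := injF_bij c_inj; exists (d z).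
(* [u], [xb], [w], [xd] are the points defeating the four translations; the
   entries [yb] and [yd] are chosen to make the columns [(xb, yb)] and
   [(yd, xd)] supply what [(u, w)] does not. *)
have [xb cxb] := c_onto (c w - u).
have [xd cxd] := c_onto (c u - w).
have [yb cyb] := c_surj (xb + (c u - u)).
have [yd cyd] := c_surj (xd + (c w - w)).
pose s := [:: [tuple u; w]; [tuple xb; yb]; [tuple yd; xd]].
apply: (@few_columns_not_orbit_condition p 1 V [:: u; w; xb; xd] s) => //.
  have xbu : u != xb.
    apply: contraNneq cu_neq_cw => ub.
    by move: cxb; rewrite -ub addrC subrK => ->.
  have xbw : w != xb.
    apply: contraNneq u_neq_w => wb; move: cxb; rewrite -wb => cw.
    apply/eqP; transitivity (w + (c w - u) - c w + u); last by ring.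
    by rewrite -cw; ring.
  have xdu : u != xd.
    apply: contraNneq u_neq_w => ud; move: cxd; rewrite -ud => cu.
    apply/eqP; transitivity (u + (c u - w) - c u + w); first by ring.
    by rewrite -cu; ring.
  have xdw : w != xd.
    apply: contraNneq cu_neq_cw => wd.
    by move: cxd; rewrite -wd addrC subrK => ->.
  have xbd : xb != xd.
    apply: contraNneq cuw => bd; move: cxd; rewrite -bd cxb => /addrI e.
    apply/eqP/(addIr (- u - w)); transitivity (c u - w); first by ring.
    by rewrite -e; ring.
  by rewrite /= !inE !negb_or u_neq_w xbu xbw xdu xdw xbd.
have s0 : [tuple u; w] \in s by rewrite !inE eqxx.
have s1 : [tuple xb; yb] \in s by rewrite !inE eqxx orbT.
have s2 : [tuple yd; xd] \in s by rewrite !inE eqxx !orbT.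
move=> a; have [x cx] := c_onto a.
have [|] := boolP (x \in [:: u; w; xb; xd]); last first.
  by left; exists x; rewrite -?cx.
have aE : a = c x - x by rewrite cx addrAC subrr add0r.
rewrite !inE => /or4P[] /eqP xE; subst x; right.
- apply: (@blocks_pair _ _ _ _ ord0 [tuple u; w] [tuple xb; yb]) => //.
    by rewrite !(tnth_nth 0) /= -cx.
  by rewrite !(tnth_nth 0) /= aE -cyb.
- apply: (@blocks_pair _ _ _ _ ord_max [tuple yd; xd] [tuple u; w]) => //.
    by rewrite !(tnth_nth 0) /= aE -cyd.
  by rewrite !(tnth_nth 0) /= -cx.
- apply: (@blocks_pair _ _ _ _ ord0 [tuple xb; yb] [tuple u; w]) => //.
    by rewrite !(tnth_nth 0) /= -cx.
  by move: cx; rewrite cxb => /addrI <-; rewrite !(tnth_nth 0) /= addrC subrK.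
- apply: (@blocks_pair _ _ _ _ ord_max [tuple u; w] [tuple yd; xd]) => //.
    by move: cx; rewrite cxd => /addrI <-; rewrite !(tnth_nth 0) /= addrC subrK.
  by rewrite !(tnth_nth 0) /= -cx.
Qed.

(** For a reflection [c], all sums [c x + x] agree and the four translations of
    the generic case are no longer distinct.  The array of three columns below
    was chosen so that for [e] = 0, 1, 2, 3 some row has, against each of the
    three rows, a position where the two entries add up to [e + e].  These
    equalities hold over the integers, hence modulo every [n]. *)
Lemma bad_values_reflection_not_orbit_condition (p : nat)
    (V : 'I_p.+4 -> {set 'I_p.+4})
    (c : 'I_p.+4 -> 'I_p.+4) (k : 'I_p.+4) :
  (forall x, c x \notin V x) -> (forall a, exists x, c x = x + a) ->
  (forall x, c x = k - x) -> ~ orbit_condition p.+3 (cyclic_sym p.+4) V.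
Proof.
move=> cV c_onto cE.
have hit x y e : x + y = e + e -> x + (c e - e) \notin V y.
  move=> xy; suff -> : x + (c e - e) = c y by [].
  by rewrite !cE; apply: (addIr y); rewrite subrK addrAC xy; ring.
pose d0 : 3.-tuple 'I_p.+4 := [tuple 0; 2; 2].
pose d1 : 3.-tuple 'I_p.+4 := [tuple - 3; 3; 3].
pose d2 : 3.-tuple 'I_p.+4 := [tuple 1; 3; 5].
apply: (@few_columns_not_orbit_condition _ _ V [:: 0; 1; 2; 3] [:: d0; d1; d2]).
- by [].
- by [].
move=> a; have [x cx] := c_onto a.
have [|] := boolP (x \in [:: 0; 1; 2; 3]); last first.
  by left; exists x; rewrite -?cx.
have s0 : d0 \in [:: d0; d1; d2] by rewrite !inE eqxx.
have s1 : d1 \in [:: d0; d1; d2] by rewrite !inE eqxx orbT.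
have s2 : d2 \in [:: d0; d1; d2] by rewrite !inE eqxx !orbT.
have -> : a = c x - x by rewrite cx addrAC subrr add0r.
rewrite !inE => /or4P[] /eqP ->; right.
- apply: (@blocks_triple _ _ _ _ (inord 0) d0 d1 d1) => //;
    apply: hit; rewrite !(tnth_nth 0) /= !inordK //=; ring.
- apply: (@blocks_triple _ _ _ _ (inord 0) d2 d0 d0) => //;
    apply: hit; rewrite !(tnth_nth 0) /= !inordK //=; ring.
- apply: (@blocks_triple _ _ _ _ (inord 1) d2 d0 d0) => //;
    apply: hit; rewrite !(tnth_nth 0) /= !inordK //=; ring.
- apply: (@blocks_triple _ _ _ _ (inord 2) d2 d1 d1) => //;
    apply: hit; rewrite !(tnth_nth 0) /= !inordK //=; ring.
Qed.

(** * The marriage *)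

Lemma orbit_condition_marriage (p : nat) (V : 'I_p.+4 -> {set 'I_p.+4}) :
  orbit_condition p.+3 (cyclic_sym p.+4) V -> marriage (cyclic_sym p.+4) V.
Proof.
have [/existsP[a /forallP aV] _|nomar] :=
  boolP [exists a : 'I_p.+4, [forall i : 'I_p.+4, i + a \in V i]].
  exists (long_cycle p.+4 ^+ a)%g => [|i]; first exact: mem_cycle.
  by rewrite long_cycleXE natr_Zp.
suff: ~ orbit_condition p.+3 (cyclic_sym p.+4) V by [].
have bad a : exists x, x + a \notin V x.
  by apply/existsP; rewrite -negb_forall; move/existsPn: nomar.
pose f a := xchoose (bad a).
have fV a : f a + a \notin V (f a) := xchooseP (bad a).
have [/forallP f_surj|] := boolP [forall x, x \in codom f]; last first.
  rewrite negb_forall => /existsP[u fu].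
  apply: (@missing_bad_point_not_orbit_condition _ _ u) => a; exists (f a) => //.
  by apply: contraNneq fu => <-; apply: codom_f.
(* [g x] is the translation defeated by [x], and [c x] the value it takes. *)
pose g x := iinv (f_surj x).
have gK : cancel g f by move=> x; apply: f_iinv.
have fK : cancel f g := canF_sym gK.
pose c x := x + g x.
have cV x : c x \notin V x by have := fV (g x); rewrite gK.
have c_onto a : exists x, c x = x + a by exists (f a); rewrite /c fK.
have [/injectiveP c_inj|/injectivePn[u [w uw cuw]]] :=
  boolP (injectiveb c); last first.
  exact: (bad_values_collide_not_orbit_condition cV c_onto uw cuw).
have [/forallP cN|] := boolP [forall x, c x + x == c 0].
  apply: (@bad_values_reflection_not_orbit_condition _ V c (c 0) cV c_onto) => x.
  by rewrite -(eqP (cN x)) addrK.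
rewrite negb_forall => /existsP[u cu].
apply: (@bad_values_generic_not_orbit_condition _ V c u 0) => //.
by rewrite [c 0 + 0]addr0.
Qed.

End Translations.

Theorem theorem1p6 (n : nat) (hn : 4 <= n) (V : 'I_n -> {set 'I_n}) :
  orbit_condition n.-1 (cyclic_sym n) V <-> marriage (cyclic_sym n) V.
Proof.
split=> [orb|]; last exact: marriage_orbit_condition.
case: n hn V orb => [|[|[|[|p]]]] // _ V orb.
exact: orbit_condition_marriage.
Qed.
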